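(* Let $\delta>0$ and let $k\geq2$ be an integer. Let $m=\mathrm{EDHJ}(k,\delta/4)$. Then for every integer $n\geq\max\{m,4k^2/\delta\}$ and every $A\subseteq[k]^n$ of equal-slices density at least $\delta$, the equal-slices density of the set of combinatorial lines contained in $A$ is at least $(\delta/9)(k+1)^{-m}$.
   Context: The equal-slices measure on $[k]^n$: choose uniformly a $k$-tuple $(a_1,\dots,a_k)$ of non-negative integers summing to $n$, then choose $x\in[k]^n$ uniformly among sequences with exactly $a_j$ coordinates equal to $j$ for each $j$. A combinatorial line in $[k]^n$: partition $[n]$ into $X_1,\dots,X_k,W$ with $W\neq\emptyset$ and take the $k$ points equal to $j$ on $X_j$ and constant on $W$. Lines (allowing also degenerate ones with $W=\emptyset$) are identified with points $y\in[k+1]^n$: $y$ corresponds to the set $\{y^{k+1\rightarrow j}:j\in[k]\}$, where $y^{k+1\rightarrow j}$ replaces every coordinate equal to $k+1$ by $j$. A line is contained in $A$ if all its points lie in $A$; the equal-slices density of a set of lines is the equal-slices measure of the corresponding subset of $[k+1]^n$. $\mathrm{EDHJ}(k,\alpha)$ is the smallest positive integer $m$ such that every subset of $[k]^m$ of equal-slices density at least $\alpha$ contains a combinatorial line (such $m$ exists). *)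

(* Defs.v *)
From HB Require Import structures.
From mathcomp Require Import all_boot all_order all_algebra.
From mathcomp Require Import reals.

Set Implicit Arguments.
Unset Strict Implicit.
Unset Printing Implicit Defensive.

Import Order.TTheory GRing.Theory Num.Theory.
Local Open Scope ring_scope.

(* [k]^n; the letters 1, ..., k are the elements of 'I_k, shifted by one. *)
Definition cube (k n : nat) := {ffun 'I_n -> 'I_k}.

(* The k-tuples of non-negative integers summing to n (each entry is <= n). *)
Definition shapes (k n : nat) : {set {ffun 'I_k -> 'I_n.+1}} :=
  [set a : {ffun 'I_k -> 'I_n.+1} | (\sum_(j < k) a j)%N == n].

Definition slice (k n : nat) (a : {ffun 'I_k -> 'I_n.+1}) : {set cube k n} :=
  [set x : cube k n | [forall j : 'I_k, #|[set i | x i == j]| == a j]].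

(* Equal-slices measure of A: uniform choice of a shape, followed by a uniform
   choice of a sequence in the corresponding slice. *)
Definition es_density (R : realType) (k n : nat) (A : {set cube k n}) : R :=
  (\sum_(a in shapes k n) #|A :&: slice a|%:R / #|slice a|%:R)
    / #|shapes k n|%:R.

(* In 'I_k.+1 the extra letter k+1 is ord_max, and lift ord_max embeds 'I_k as
   the other letters.  subst y j is y^{k+1 -> j}. *)
Definition subst (k n : nat) (y : cube k.+1 n) (j : 'I_k) : cube k n :=
  [ffun i => odflt j (unlift ord_max (y i))].

Definition wildcards (k n : nat) (y : cube k.+1 n) : {set 'I_n} :=
  [set i | y i == ord_max].

Definition line (k n : nat) (y : cube k.+1 n) : {set cube k n} :=
  [set subst y j | j : 'I_k].

(* The combinatorial lines contained in A, as points of [k+1]^n; points with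
   empty wildcard set encode degenerate lines and are excluded. *)
Definition lines_in (k n : nat) (A : {set cube k n}) : {set cube k.+1 n} :=
  [set y : cube k.+1 n | (wildcards y != set0) && (line y \subset A)].

Definition forces_line (R : realType) (k : nat) (alpha : R) (m : nat) : Prop :=
  forall A : {set cube k m}, alpha <= es_density R A ->
    exists y : cube k.+1 m, y \in lines_in A.

(* m = EDHJ(k, alpha). *)
Definition is_EDHJ (R : realType) (k : nat) (alpha : R) (m : nat) : Prop :=
  [/\ (0 < m)%N, forces_line k alpha m &
      forall m' : nat, (0 < m')%N -> forces_line k alpha m' -> (m <= m')%N].

(* Main.v *)
(* The equal-slices measure of a point x is proportional to the weight
   prod_j c_j(x)!, where c_j(x) counts the coordinates equal to j, and this is
   the law of a Polya urn.  Hence [k]^(n+1) is sampled exactly by sampling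
   [k]^n and inserting, at a uniformly random position, a coordinate that either
   copies one of the other n coordinates or is a fixed letter of [k], the n + k
   choices being equally likely.  The n-dimensional subspaces arising in this
   way sample the nondegenerate lines of [k]^(n+1) exactly as well, so a lower
   bound for the line density that is affine in the density of A passes from
   dimension m to any dimension n >= m.  In dimension m, removing from A one
   point of each line in A leaves a line-free set, of density less than delta/4,
   and each removed point weighs at most 2^m times its line. *)
Require Import Defs.
From HB Require Import structures.
From mathcomp Require Import all_boot all_order all_algebra.
From mathcomp Require Import reals.
From mathcomp Require Import zify ring lra.

Import Order.TTheory GRing.Theory Num.Theory.
Local Open Scope nat_scope.

(** * Weights and the insertion of one coordinate *)

Definition letter_count {k n} (x : cube k n) (j : 'I_k) : nat :=
  #|[set i | x i == j]|.

Definition weight {k n} (x : cube k n) : nat := \prod_(j < k) (letter_count x j)`!.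

Definition mass {k n} (A : {set cube k n}) : nat := \sum_(x in A) weight x.

Definition insert {k n} (i0 : 'I_n.+1) (z : cube k n) (j : 'I_k) : cube k n.+1 :=
  [ffun i => oapp z j (unlift i0 i)].

Definition delete {k n} (i0 : 'I_n.+1) (x : cube k n.+1) : cube k n :=
  [ffun i => x (lift i0 i)].

Lemma insert_at {k n} i0 (z : cube k n) j : insert i0 z j i0 = j.
Proof. by rewrite ffunE unlift_none. Qed.

Lemma insert_lift {k n} i0 (z : cube k n) j i : insert i0 z j (lift i0 i) = z i.
Proof. by rewrite ffunE liftK. Qed.

Lemma insertK {k n} i0 (z : cube k n) j : delete i0 (insert i0 z j) = z.
Proof. by apply/ffunP => i; rewrite ffunE insert_lift. Qed.

Lemma deleteK {k n} i0 (x : cube k n.+1) : insert i0 (delete i0 x) (x i0) = x.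
Proof.
by apply/ffunP => i; rewrite ffunE; case: unliftP => [i' ->|->] //=; rewrite ffunE.
Qed.

Lemma sum_insert {k n} (i0 : 'I_n.+1) (F : cube k n.+1 -> nat) :
  \sum_x F x = \sum_(z : cube k n) \sum_(j < k) F (insert i0 z j).
Proof.
rewrite pair_bigA /=.
rewrite (reindex (fun p : cube k n * 'I_k => insert i0 p.1 p.2)) //=.
exists (fun x => (delete i0 x, x i0)) => [[z j] _|x _] /=.
  by rewrite insertK insert_at.
exact: deleteK.
Qed.

Lemma letter_count_sum {k n} (x : cube k n) j :
  letter_count x j = \sum_(i < n) (x i == j).
Proof. by rewrite /letter_count -sum1dep_card big_mkcond; apply: eq_bigr => i _; case: eqP. Qed.

Lemma sum_letter_count {k n} (x : cube k n) : \sum_(j < k) letter_count x j = n.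
Proof.
under eq_bigr do rewrite letter_count_sum.
rewrite exchange_big /= -[RHS]card_ord -sum1_card; apply: eq_bigr => i _.
rewrite (bigD1 (x i)) //= eqxx big1 // => j; rewrite eq_sym => /negbTE -> //.
Qed.

Lemma letter_count_insert {k n} i0 (z : cube k n) j l :
  letter_count (insert i0 z j) l = letter_count z l + (j == l).
Proof.
rewrite !letter_count_sum (bigD1_ord i0) //= insert_at addnC; congr (_ + _).
by apply: eq_bigr => i _; rewrite insert_lift.
Qed.

Lemma weight_insert {k n} i0 (z : cube k n) j :
  weight (insert i0 z j) = (letter_count z j).+1 * weight z.
Proof.
rewrite /weight (bigD1 j) //= [in RHS](bigD1 j) //= mulnA -factS.
rewrite letter_count_insert eqxx addn1; congr (_ * _).
by apply: eq_bigr => l; rewrite letter_count_insert eq_sym => /negbTE ->; rewrite addn0.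
Qed.

(** * Total masses and the normalised density *)

(** The urn factors [(letter_count z j).+1] sum over j to n + k, whatever z is. *)
Lemma mass_setT_S k n :
  mass [set: cube k n.+1] = (n + k) * mass [set: cube k n].
Proof.
rewrite /mass !(eq_bigl predT) => [|x|x]; rewrite ?inE //.
rewrite (sum_insert ord0) big_distrr /=; apply: eq_bigr => z _.
under eq_bigr do rewrite weight_insert -addn1.
by rewrite -big_distrl /= big_split /= sum_letter_count sum1_card card_ord.
Qed.

Lemma letter_count0 {k} (x : cube k 0) j : letter_count x j = 0.
Proof. by rewrite letter_count_sum big_ord0. Qed.

Lemma weight0 {k} (x : cube k 0) : weight x = 1.
Proof. by rewrite /weight big1 // => j _; rewrite letter_count0. Qed.

Lemma mass_setT_0 k : mass [set: cube k 0] = 1.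
Proof.
rewrite /mass (eq_bigr (fun=> 1)) => [|x _]; last exact: weight0.
by rewrite sum1_card cardsT card_ffun !card_ord.
Qed.

Lemma mass_setT_gt0 k n : 0 < k -> 0 < mass [set: cube k n].
Proof.
move=> k0; elim: n => [|n IHn]; first by rewrite mass_setT_0.
by rewrite mass_setT_S muln_gt0 IHn addn_gt0 k0 orbT.
Qed.

(** The two masses are the rising factorials (k+1)...(k+n) and k...(k+n-1). Their ratio converts
    between normalisations for lines and points. *)
Lemma mass_setT_extra_letter k n :
  k * mass [set: cube k.+1 n] = (n + k) * mass [set: cube k n].
Proof.
elim: n => [|n IHn]; first by rewrite !mass_setT_0.
by rewrite !mass_setT_S mulnCA IHn addSnnS.
Qed.

(* The weight is constantly prod_j a_j! on the slice, so this is the multinomial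
   formula |slice a| = n! / prod_j a_j!. *)
Lemma sum_weight_slice {k} n (a : 'I_k -> nat) : \sum_(j < k) a j = n ->
  \sum_(x : cube k n | [forall j, letter_count x j == a j]) weight x = n`!.
Proof.
elim: n a => [|n IHn] a sum_a.
  rewrite (eq_bigl predT) => [|x].
    by rewrite (eq_bigr (fun=> 1)) => [|x _]; rewrite ?weight0 // sum1_card card_ffun !card_ord.
  apply/forallP => j; rewrite letter_count0 eq_sym.
  by rewrite -leqn0 -sum_a (bigD1 j) //= leq_addr.
rewrite big_mkcond (sum_insert ord0) exchange_big factS -[X in _ = X * _]sum_a big_distrl /=.
apply: eq_bigr => j _.
(* The subtraction below is truncated, so a_j = 0 is treated apart: no point of the slice then
   starts with j. *)
have [a0|a_gt0] := posnP (a j).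
  rewrite a0 big1 // => z _; case: ifP => // /forallP /(_ j).
  by rewrite letter_count_insert eqxx a0 addn1.
rewrite -(IHn (fun l => a l - (j == l))); last first.
  move: sum_a; rewrite (bigD1 j) //= [in X in _ -> X](bigD1 j) //= eqxx.
  rewrite [X in _ -> _ + X = _](eq_bigr a) => [|l]; first by lia.
  by rewrite eq_sym => /negbTE ->; rewrite subn0.
rewrite big_distrr [RHS]big_mkcond /=; apply: eq_bigr => z _.
have -> : [forall l, letter_count (insert ord0 z j) l == a l] =
          [forall l, letter_count z l == a l - (j == l)].
  apply: eq_forallb => l; rewrite letter_count_insert.
  by case: (j =P l) => [<-|_] /=; lia.
case: forallP => // /(_ j); rewrite eqxx => /eqP Hj.
by rewrite weight_insert Hj -subSn // subn1.
Qed.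

(** The weight is constant on each slice and sums to n! there, so all shapes carry the same mass and
    the two-stage choice is sampling by weight. *)
Lemma es_densityE (R : realType) (k n : nat) (A : {set cube k n}) :
  es_density R A = ((mass A)%:R / (mass [set: cube k n])%:R)%R.
Proof.
have sliceE (a : {ffun 'I_k -> 'I_n.+1}) x :
    (x \in slice a) = [forall j, letter_count x j == a j].
  by rewrite inE.
have weight_slice (a : {ffun 'I_k -> 'I_n.+1}) x :
    x \in slice a -> weight x = \prod_(j < k) (a j)`!.
  rewrite sliceE => /forallP Hx; apply: eq_bigr => j _.
  by rewrite (eqP (Hx j)).
have card_slice (a : {ffun 'I_k -> 'I_n.+1}) : a \in shapes k n ->
    #|slice a| * \prod_(j < k) (a j)`! = n`!.
  rewrite inE => /eqP sum_a; rewrite -(sum_weight_slice _ _ sum_a).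
  rewrite -sum_nat_const; under [RHS]eq_bigl do rewrite -sliceE.
  by apply: eq_bigr => x xa; rewrite (weight_slice a).
have massE (B : {set cube k n}) :
    mass B = \sum_(a in shapes k n) \sum_(x in B :&: slice a) weight x.
  pose sh (x : cube k n) : {ffun 'I_k -> 'I_n.+1} :=
    [ffun j => inord (letter_count x j)].
  have shE x j : sh x j = letter_count x j :> nat.
    rewrite ffunE inordK // ltnS -[X in _ <= X](sum_letter_count x).
    by rewrite (bigD1 j) //= leq_addr.
  rewrite /mass (partition_big sh (mem (shapes k n))) => [|x _] /=; last first.
    rewrite inE; under eq_bigr do rewrite shE.
    by rewrite sum_letter_count.
  apply: eq_bigr => a _; apply: eq_bigl => x; rewrite !in_setI sliceE.
  congr (_ && _); apply/eqP/forallP => [<- j|Hx]; first by rewrite shE.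
  by apply/ffunP => j; apply/val_inj; rewrite /= shE (eqP (Hx j)).
have fact0 : (n`!%:R != 0 :> R)%R by rewrite pnatr_eq0 -lt0n fact_gt0.
have sumE (B : {set cube k n}) :
    (\sum_(a in shapes k n) #|B :&: slice a|%:R / #|slice a|%:R
      = (mass B)%:R / n`!%:R :> R)%R.
  rewrite massE natr_sum mulr_suml; apply: eq_bigr => a sa.
  have := card_slice a sa; have := fact_gt0 n.
  set P := (X in _ * X = _) => n0 cP.
  rewrite (eq_bigr (fun=> P)) => [|x]; last by rewrite in_setI => /andP[_ /weight_slice].
  rewrite sum_nat_const natrM -cP natrM.
  have : #|slice a| * P != 0 by rewrite cP -lt0n.
  rewrite muln_eq0 negb_or -!(pnatr_eq0 R) => /andP[h1 h2].
  by field; rewrite h1 h2.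
have card_shapes : (#|shapes k n|%:R = (mass [set: cube k n])%:R / n`!%:R :> R)%R.
  rewrite -sumE -sum1_card natr_sum; apply: eq_bigr => a sa.
  rewrite setTI divff // pnatr_eq0 -lt0n.
  by move: (fact_gt0 n); rewrite -(card_slice a sa) muln_gt0 => /andP[].
rewrite /es_density sumE card_shapes invf_div mulrACA mulrA.
by rewrite [X in (X * _)%R]mulrAC divfK // .
Qed.

(** * One-coordinate embeddings of points and lines *)

(* The embedding of [k]^n into [k]^(n+1) that inserts at i0 either a copy of
   coordinate i (c = inl i) or the fixed letter e j (c = inr j); taking e = id
   for points and e = lift ord_max for lines excludes the fixed letter k+1. *)
Definition extend {k l n} (e : 'I_l -> 'I_k) (i0 : 'I_n.+1) (c : 'I_n + 'I_l)
    (z : cube k n) : cube k n.+1 :=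
  insert i0 z (match c with inl i => z i | inr j => e j end).

(** The choices c inserting j are the coordinates of z equal to j and the j' with [e j' = j];
    grouping by inserted letter serves points and lines alike. *)
Lemma sum_extend {k l n} (e : 'I_l -> 'I_k) (i0 : 'I_n.+1)
    (F : cube k n.+1 -> nat) :
  \sum_c \sum_z F (extend e i0 c z) * weight z =
  \sum_z \sum_(j < k) F (insert i0 z j) *
    ((letter_count z j + \sum_(j' < l) (e j' == j)) * weight z).
Proof.
rewrite exchange_big; apply: eq_bigr => z _ /=.
pose G j := F (insert i0 z j) * weight z.
have pick (j0 : 'I_k) : G j0 = \sum_(j < k) (j0 == j) * G j.
  rewrite (bigD1 j0) //= eqxx mul1n big1 ?addn0 // => j.
  by rewrite eq_sym => /negbTE ->.
rewrite big_sumType /=.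
under eq_bigr => i _ do rewrite -/(G (z i)) pick.
under [X in _ + X]eq_bigr => j _ do rewrite -/(G (e j)) pick.
rewrite exchange_big [X in _ + X]exchange_big -big_split /=; apply: eq_bigr => j _.
by rewrite -!big_distrl -mulnDl letter_count_sum mulnCA.
Qed.

Lemma mass_indicator {k n} (A : {set cube k n}) :
  mass A = \sum_x (x \in A) * weight x.
Proof.
rewrite /mass big_mkcond; apply: eq_bigr => x _.
by case: (x \in A); rewrite ?mul1n.
Qed.

(** With [e = id] the letter j comes from [(letter_count z j).+1] choices, exactly the urn factor,
    so each position contributes [mass A]. *)
Lemma sum_mass_extend {k n} (A : {set cube k n.+1}) :
  \sum_(i0 < n.+1) \sum_c mass [set z | extend id i0 c z \in A] = n.+1 * mass A.
Proof.
rewrite -[X in _ = X * _]card_ord -sum_nat_const; apply: eq_bigr => i0 _.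
under eq_bigr => c _ do
  (rewrite mass_indicator; under eq_bigr => z _ do rewrite inE).
rewrite (sum_extend _ _ (fun x => nat_of_bool (x \in A))) mass_indicator (sum_insert i0).
apply: eq_bigr => z _; apply: eq_bigr => j _; rewrite weight_insert.
rewrite (bigD1 j) //= eqxx big1 ?addn1 // => j' /negbTE -> //.
Qed.

(** Copying a coordinate commutes with substitution, and an inserted fixed letter is never the
    wildcard. *)
Lemma subst_extend {k n} (i0 : 'I_n.+1) c (z : cube k.+1 n) j :
  subst (extend (lift ord_max) i0 c z) j = extend id i0 c (subst z j).
Proof.
apply/ffunP => i; rewrite ffunE /extend; case: (unliftP i0 i) => [i'|] ->.
  by rewrite !insert_lift ffunE.
by rewrite !insert_at; case: c => [i'|j']; rewrite ?ffunE ?liftK.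
Qed.

Lemma lines_in_extend {k n} (A : {set cube k n.+1}) i0 c (z : cube k.+1 n) :
  z \in lines_in [set x | extend id i0 c x \in A] ->
  extend (lift ord_max) i0 c z \in lines_in A.
Proof.
rewrite !inE => /andP[/set0Pn[i]]; rewrite inE => /eqP zi /subsetP zA.
apply/andP; split.
  by apply/set0Pn; exists (lift i0 i); rewrite inE insert_lift zi.
apply/subsetP => _ /imsetP[j _ ->]; rewrite subst_extend.
by have := zA (subst z j); rewrite inE; apply; apply: imset_f.
Qed.

(** Deleting one of w wildcards divides the weight by w, and there are w ways to do it. *)
Lemma wildcard_deletions {k n} (y : cube k.+1 n.+1) : wildcards y != set0 ->
  \sum_(i0 | y i0 == ord_max) weight (delete i0 y) = weight y.
Proof.
rewrite -card_gt0 => w_gt0; apply/eqP; rewrite -(eqn_pmul2l w_gt0); apply/eqP.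
rewrite big_distrr /= -sum_nat_const.
under [RHS]eq_bigl do rewrite inE.
apply: eq_bigr => i0 /eqP yi0.
rewrite -[in RHS](deleteK i0 y) weight_insert; congr (_ * _).
have := letter_count_insert i0 (delete i0 y) (y i0) (y i0).
by rewrite deleteK eqxx yi0 addn1 => <-.
Qed.

(** A line y collects [weight y] at each of the n + 1 positions, except that at a wildcard i0 the
    excluded fixed letter costs [weight (delete i0 y)]. By [wildcard_deletions] the total loss is
    one [weight y], which turns n + 1 into n. *)
Lemma sum_mass_lines_extend {k n} (A : {set cube k n.+1}) :
  \sum_(i0 < n.+1) \sum_c mass (lines_in [set z | extend id i0 c z \in A])
    <= n * mass (lines_in A).
Proof.
pose b (j : 'I_k.+1) : nat := j != ord_max.
pose H i0 (y : cube k.+1 n.+1) :=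
  (letter_count (delete i0 y) (y i0) + b (y i0)) * weight (delete i0 y).
have be j : \sum_(j' < k) (lift ord_max j' == j) = b j.
  rewrite /b; case: (unliftP ord_max j) => [j0|] ->.
    rewrite (bigD1 j0) //= eqxx eq_sym neq_lift big1 // => j' j'j.
    by rewrite (inj_eq lift_inj) (negbTE j'j).
  by rewrite eqxx big1 // => j' _; rewrite eq_sym (negbTE (neq_lift _ _)).
apply: (@leq_trans (\sum_(i0 < n.+1) \sum_y (y \in lines_in A) * H i0 y)).
  apply: leq_sum => i0 _; rewrite (sum_insert i0).
  rewrite (eq_bigr (fun z => \sum_(j < k.+1) (insert i0 z j \in lines_in A) *
    ((letter_count z j + \sum_(j' < k) (lift ord_max j' == j)) * weight z))); last first.
    by move=> z _; apply: eq_bigr => j _; rewrite /H insertK insert_at be.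
  rewrite -(sum_extend _ _ (fun x => nat_of_bool (x \in lines_in A))).
  apply: leq_sum => c _; rewrite mass_indicator.
  apply: leq_sum => z _; rewrite leq_mul2r orbC.
  by case: (boolP (z \in _)) => // /lines_in_extend ->.
rewrite exchange_big mass_indicator big_distrr /=.
apply: leq_sum => y _; rewrite -big_distrr /= mulnCA leq_mul2l.
case: (boolP (y \in _)) => //=; rewrite inE => /andP[wy _].
have HE i0 : H i0 y + (if y i0 == ord_max then weight (delete i0 y) else 0) = weight y.
  rewrite -[in RHS](deleteK i0 y) weight_insert /H /b.
  by case: eqP => _ /=; lia.
rewrite -(leq_add2r (weight y)) -{1}(wildcard_deletions y wy).
rewrite [X in _ + X]big_mkcond -big_split /= (eq_bigr (fun=> weight y)) //.
by rewrite sum_nat_const card_ord mulSn addnC.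
Qed.

(** * Removing a point from every line *)

(** Substitution merges a letters j with w wildcards, and (a+w)! = C(a+w,w) a! w! with C(a+w,w) <=
    2^n. *)
Lemma weight_subst {k n} (y : cube k.+1 n) j :
  weight (subst y j) <= 2 ^ n * weight y.
Proof.
have cnt l : letter_count (subst y j) l =
    letter_count y (lift ord_max l) + (j == l) * letter_count y ord_max.
  rewrite !letter_count_sum big_distrr -big_split; apply: eq_bigr => i _ /=.
  rewrite ffunE; case: (unliftP ord_max (y i)) => [l'|] -> /=.
    by rewrite (inj_eq lift_inj) eq_sym eq_sym (eq_sym _ ord_max) (negbTE (neq_lift _ _)) muln0 addn0.
  by rewrite (negbTE (neq_lift _ _)) eqxx muln1.
rewrite /weight big_ord_recr /=.
have wid l : widen_ord (leqnSn k) l = lift ord_max l.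
  by apply/val_inj; rewrite /= /bump leqNgt ltn_ord.
under [X in _ <= _ * (X * _)]eq_bigr do rewrite wid.
rewrite (bigD1 j) //= [X in _ <= _ * (X * _)](bigD1 j) //=.
rewrite (eq_bigr (fun l => (letter_count y (lift ord_max l))`!)); last first.
  by move=> l; rewrite eq_sym cnt => /negbTE ->; rewrite addn0.
rewrite cnt eqxx mul1n; set a := letter_count y _; set w := letter_count y _.
have aw : a + w <= n.
  rewrite -[X in _ <= X](sum_letter_count y) (bigD1 ord_max) //= -/w.
  by rewrite (bigD1 (lift ord_max j)) ?(eq_sym _ ord_max) ?neq_lift //= -/a; lia.
set P := \prod_(_ | _) _.
have bin_le : 'C(a + w, w) <= 2 ^ n.
  apply: leq_trans (leq_pexp2l _ aw) => //.
  rewrite -[2]/(1 + 1) expnDn.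
  have lt_w : w < (a + w).+1 by rewrite ltnS leq_addl.
  rewrite (bigD1 (Ordinal lt_w)) //= !exp1n !muln1; exact: leq_addr.
have := bin_fact (leq_addl a w); rewrite addnK => <-.
by rewrite -!mulnA; apply: leq_mul => //; rewrite [a`! * _]mulnC !mulnA; lia.
Qed.

Lemma removal_line_free {k n} (A : {set cube k n}) (j : 'I_k) :
  lines_in (A :\: [set subst y j | y in lines_in A]) = set0.
Proof.
apply/setP => y; rewrite in_set0; apply/negP; rewrite inE => /andP[wy /subsetP yB].
have yA : y \in lines_in A.
  by rewrite inE wy; apply/subsetP => x /yB; rewrite inE => /andP[].
have yj : subst y j \in line y by exact: imset_f.
by have := yB _ yj; rewrite in_setD (imset_f (fun y => subst y j) yA).
Qed.

Lemma mass_removal {k n} (A : {set cube k n}) (j : 'I_k) :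
  mass A <= mass (A :\: [set subst y j | y in lines_in A])
            + 2 ^ n * mass (lines_in A).
Proof.
set P := [set _ | _ in _].
rewrite {1}/mass (big_setID P) /= addnC leq_add2l.
apply: (@leq_trans (\sum_(x in P) weight x)).
  by rewrite [leqRHS](big_setID A) /= setIC leq_addr.
rewrite /mass big_distrr /= (partition_big_imset (fun y => subst y j)) /=.
apply: leq_sum => x /imsetP[y yA ->].
(* Several lines may share the removed point; one of them already pays for it. *)
rewrite (bigD1 y) ?yA ?eqxx //=.
by apply: leq_trans (weight_subst y j) _; apply: leq_addr.
Qed.

(** * Numerical bound, transfer to dimension n, and conclusion *)

(** Absorbs the removal loss 2^m and the mass ratio (m+k)/k into (k+1)^m. An induction step costs
    2(k+1), at most k(k+1). *)
Lemma exp2_bound k m : 2 <= k -> 2 ^ m * (m + k) <= k * k.+1 ^ m.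
Proof.
move=> k_ge2; elim: m => [|m IHm]; first by rewrite !expn0; lia.
have le_exp : 2 ^ m <= k.+1 ^ m.
  by case: (posnP m) => [->|m_gt0]; [rewrite !expn0 | rewrite leq_exp2r // leqW].
rewrite !expnS; apply: (@leq_trans (2 * (k.+1 * k.+1 ^ m))); first by lia.
by rewrite mulnCA [leqRHS]mulnCA leq_mul2l leq_mul2r k_ge2 !orbT.
Qed.

Local Open Scope ring_scope.

(** The left side may be negative, so that averaging over embeddings also covers those whose
    preimage of A is sparse. *)
Lemma base_case (R : realType) (k m : nat) (alpha : R) (A : {set cube k m}) :
  (0 < k)%N -> forces_line k alpha m ->
  (mass A)%:R - alpha * (mass [set: cube k m])%:R
    <= 2 ^+ m * (mass (lines_in A))%:R :> R.
Proof.
move=> k_gt0 forces; pose j := Ordinal k_gt0.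
pose B := A :\: [set subst y j | y in lines_in A].
have B_sparse : es_density R B < alpha.
  rewrite ltNge; apply/negP => /forces[y].
  by rewrite removal_line_free in_set0.
move: B_sparse; rewrite es_densityE ltr_pdivrMr ?ltr0n ?mass_setT_gt0 // => B_sparse.
have := mass_removal A j; rewrite -(ler_nat R) natrD natrM natrX -/B.
move: B_sparse; lra.
Qed.

(** Summed over the (n+1)(n+k) embeddings, the point side gains a factor n + 1 and the line side at
    most n; the coefficient [c * n] is the one that this ratio preserves. *)
Lemma lines_mass_lower_bound (R : realType) (k m n : nat) (c alpha : R) :
  (0 < m <= n)%N ->
  (forall A : {set cube k m},
     c * m%:R * ((mass A)%:R - alpha * (mass [set: cube k m])%:R)
       <= (mass (lines_in A))%:R) ->
  forall A : {set cube k n},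
    c * n%:R * ((mass A)%:R - alpha * (mass [set: cube k n])%:R)
      <= (mass (lines_in A))%:R.
Proof.
move=> /andP[m_gt0 le_mn] base; move: le_mn.
elim: n => [|n IHn]; first by lia.
rewrite leq_eqVlt => /orP[/eqP <- //|]; rewrite ltnS => le_mn A.
have n_gt0 : (0 < n)%N by exact: leq_trans le_mn.
rewrite -(@ler_pM2l _ n%:R) ?ltr0n //.
have := sum_mass_lines_extend A; rewrite -(ler_nat R) natrM => /(le_trans _); apply.
pose f i0 c0 := [set z : cube k n | extend id i0 c0 z \in A].
pose M := (mass [set: cube k n])%:R : R.
apply: (@le_trans _ _ (\sum_(i0 < n.+1) \sum_(c0 : 'I_n + 'I_k)
   c * n%:R * ((mass (f i0 c0))%:R - alpha * M))); last first.
  rewrite natr_sum; apply: ler_sum => i0 _; rewrite natr_sum.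
  by apply: ler_sum => c0 _; exact: IHn.
under eq_bigr => i0 _ do rewrite -mulr_sumr sumrB -natr_sum.
rewrite -mulr_sumr sumrB -natr_sum sum_mass_extend.
rewrite !sumr_const !card_sum !card_ord mass_setT_S.
rewrite -mulrnA -[alpha * M *+ _]mulr_natr !natrM -/M.
by rewrite le_eqVlt; apply/orP; left; apply/eqP; ring.
Qed.

Theorem theorem3p8 (R : realType) (delta : R) (k m : nat)
    (delta_gt0 : 0 < delta) (k_ge2 : (2 <= k)%N)
    (m_EDHJ : is_EDHJ k (delta / 4%:R) m)
    (n : nat) (n_ge : Num.max m%:R (4%:R * k%:R ^+ 2 / delta) <= n%:R)
    (A : {set cube k n}) (A_dense : delta <= es_density R A) :
  delta / 9%:R * (k.+1%:R ^+ m)^-1 <= es_density R (lines_in A).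
Proof.
case: m_EDHJ => m_gt0 forces _.
have le_mn : (m <= n)%N by move: n_ge; rewrite ge_max ler_nat => /andP[].
have k_gt0 : (0 < k)%N by exact: leq_trans k_ge2.
have n_gt0 : (0 < n)%N by exact: leq_trans le_mn.
have m0 : 0 < m%:R :> R by rewrite ltr0n.
have n0 : 0 < n%:R :> R by rewrite ltr0n.
have k0 : 0 < k%:R :> R by rewrite ltr0n.
have e0 : 0 < 2 ^+ m :> R by rewrite exprn_gt0.
have K0 : 0 < k.+1%:R ^+ m :> R by rewrite exprn_gt0 ?ltr0n.
set M := (mass [set: cube k n])%:R : R.
have M0 : 0 < M by rewrite ltr0n mass_setT_gt0.
(* The constant is c = 1/(m 2^m), so that c m is the 2^-m of [base_case]. *)
have base (B : {set cube k m}) :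
    (m%:R * 2 ^+ m)^-1 * m%:R *
      ((mass B)%:R - delta / 4%:R * (mass [set: cube k m])%:R)
    <= (mass (lines_in B))%:R.
  have -> : (m%:R * 2 ^+ m)^-1 * m%:R = (2 ^+ m)^-1 :> R.
    by field; rewrite !gt_eqF.
  by rewrite ler_pdivrMl //; exact: base_case.
have := lines_mass_lower_bound _ _ _ n _ _ _ base A.
rewrite m_gt0 le_mn -/M => /(_ isT) lines_large.
move: A_dense; rewrite !es_densityE ler_pdivlMr // => A_dense.
set M' := (mass [set: cube k.+1 n])%:R : R.
have M'E : k%:R * M' = (n%:R + k%:R) * M.
  by rewrite -natrD -!natrM mass_setT_extra_letter.
have M'0 : 0 < M' by rewrite ltr0n mass_setT_gt0.
rewrite ler_pdivlMr //; apply: le_trans lines_large.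
have sum_le : 3%:R / 4%:R * delta * M <= (mass A)%:R - delta / 4%:R * M.
  by move: A_dense; rewrite -/M; lra.
apply: le_trans (ler_wpM2l _ sum_le); last first.
  by rewrite mulr_ge0 ?invr_ge0 ?mulr_ge0 // ltW.
have -> : M' = (n%:R + k%:R) * M / k%:R by rewrite -M'E [k%:R * M']mulrC mulfK ?gt_eqF.
have exp_le : 2 ^+ m * (m%:R + k%:R) <= k%:R * k.+1%:R ^+ m :> R.
  by rewrite -natrD -!natrX -!natrM ler_nat exp2_bound.
have mn : m%:R <= n%:R :> R by rewrite ler_nat.
(* (n + k) / n <= (m + k) / m <= k (k + 1)^m / (m 2^m) *)
have key : m%:R * 2 ^+ m * (n%:R + k%:R) <= n%:R * (k%:R * k.+1%:R ^+ m) :> R.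
  apply: le_trans (ler_wpM2l (ltW n0) exp_le).
  have : 0 <= 2 ^+ m * (k%:R * (n%:R - m%:R)) :> R.
    by apply: mulr_ge0 (ltW e0) (mulr_ge0 (ltW k0) _); rewrite subr_ge0.
  lra.
(* With Y and X the left and right sides of [key], the difference is a positive multiple of 3/4 X -
   1/9 Y, and 0 <= Y <= X. *)
rewrite -subr_ge0.
have -> : (m%:R * 2 ^+ m)^-1 * n%:R * (3%:R / 4%:R * delta * M) -
    delta / 9%:R * (k.+1%:R ^+ m)^-1 * ((n%:R + k%:R) * M / k%:R) =
    delta * M / (m%:R * 2 ^+ m * (k%:R * k.+1%:R ^+ m)) *
    (3%:R / 4%:R * (n%:R * (k%:R * k.+1%:R ^+ m))
      - 1 / 9%:R * (m%:R * 2 ^+ m * (n%:R + k%:R))) :> R.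
  by field; rewrite !gt_eqF.
apply: mulr_ge0; first by rewrite ltW // divr_gt0 // !mulr_gt0.
have : 0 <= m%:R * 2 ^+ m * (n%:R + k%:R) :> R.
  by rewrite ltW // !mulr_gt0 // addr_gt0.
move: key; lra.
Qed.
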